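(* Let $k\geq 1$ be an integer, let $q\equiv 2k+1 \pmod{4k}$ be a prime power, and let $V=V_0\cup V_1\cup\dots\cup V_{k-1}$ be a cyclotomic half-set of $\mathbb{F}_q$ of order $2k$ (with $V_i=(-1)^{\alpha_i}C^{2k}_i$ as in the context). If there exists a $(V,k,r)$ Heffter difference matrix, then there exists a $(\frac{q-1}{2},k;r)$ Heffter space. If the matrix is simple, the Heffter space is simple as well.
   Context: Let $g$ be a fixed primitive element of $\mathbb{F}_q$. $C^{2k}$ denotes the subgroup of index $2k$ of $\mathbb{F}_q^*$, and $C^{2k}_i=g^iC^{2k}$ for $0\le i\le 2k-1$ (the cyclotomic classes of order $2k$). Since $q\equiv 2k+1 \pmod{4k}$, $-1\in C^{2k}_k$. A cyclotomic half-set of $\mathbb{F}_q$ of order $2k$ is a set $V=\bigcup_{i=0}^{k-1}(-1)^{\alpha_i}C^{2k}_i$ with $\alpha_i\in\{0,1\}$; one writes $V_i=(-1)^{\alpha_i}C^{2k}_i$ and assumes $\alpha_0=0$. A $(V,k,r)$ Heffter difference matrix is an $r\times k$ matrix $B=(b_{h,i})$ (rows indexed $1,\dots,r$, columns $0,\dots,k-1$) with entries in $\mathbb{F}_q$ such that: (i) every row is zero-sum in $\mathbb{F}_q$; (ii) every entry of column $i$ lies in $V_i$, for $0\le i\le k-1$; (iii) for $0\le i<j\le k-1$ the multiset $\{b_{h,i}/b_{h,j} : 1\le h\le r\}$ has no repeated elements. It is simple if, for each row $(b_{h,0},\dots,b_{h,k-1})$, the partial sums $b_{h,0}, b_{h,0}+b_{h,1},\dots,b_{h,0}+\dots+b_{h,k-1}$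 are pairwise distinct. A $(v_r,b_k)$ configuration is a point-block incidence structure $(V,\mathcal{B})$ with $v$ points and $b$ blocks, each block a $k$-subset, any two distinct points in at most one common block, every point in exactly $r$ blocks; it is resolvable if $\mathcal{B}$ partitions into $r$ parallel classes, each a partition of $V$. A half-set of an abelian group $G$ is $V\subseteq G$ with $V$ and $-V$ partitioning $G\setminus\{0\}$. A $(v,k;r)$ Heffter space over an abelian group $G$ is a resolvable $(v_r,b_k)$ configuration whose point set is a half-set of $G$ and whose blocks are all zero-sum in $G$. It is simple if every block can be ordered so that its partial sums are pairwise distinct. *)

(* Defs.v *)
From HB Require Import structures.
From mathcomp Require Import all_boot all_order all_algebra all_fingroup all_solvable.

Set Implicit Arguments.
Unset Strict Implicit.
Unset Printing Implicit Defensive.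

Import GRing.Theory.
Local Open Scope ring_scope.

(* [scanl +%R 0 [:: x1; ...; xn]] is [:: x1; x1 + x2; ...; x1 + ... + xn]:
   the initial 0 is not listed, the total sum is. *)
Definition simple_seq (G : finZmodType) (s : seq G) : Prop :=
  uniq (scanl +%R 0 s).

Section Configurations.
Variable T : finType.
Implicit Types (P : {set T}) (Bl : {set {set T}}).

Definition configuration (v r b k : nat) P Bl : Prop :=
  [/\ #|P| = v /\ #|Bl| = b,
      forall A, A \in Bl -> A \subset P /\ #|A| = k,
      forall x y, x \in P -> y \in P -> x != y ->
        (#|[set A in Bl | (x \in A) && (y \in A)]| <= 1)%N
    & forall x, x \in P -> #|[set A in Bl | x \in A]| = r].

Definition parallel_class P (C : {set {set T}}) : Prop := partition C P.

Definition resolvable (r : nat) P Bl : Prop :=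
  exists R : {set {set {set T}}},
    [/\ partition R Bl, #|R| = r & forall C, C \in R -> parallel_class P C].

End Configurations.

Section HeffterSpaces.
Variable G : finZmodType.
Implicit Types (P A : {set G}) (Bl : {set {set G}}).

Definition half_set P : Prop :=
  [disjoint P & [set - x | x in P]] /\ P :|: [set - x | x in P] = ~: [set 0].

Definition zero_sum A : Prop := \sum_(x in A) x = 0.

Definition heffter_space (v k r : nat) P Bl : Prop :=
  [/\ exists b, configuration v r b k P Bl,
      resolvable r P Bl,
      half_set P
    & forall A, A \in Bl -> zero_sum A].

Definition simple_space Bl : Prop :=
  forall A, A \in Bl -> exists s, perm_eq s (enum A) /\ simple_seq s.

End HeffterSpaces.

Section Cyclotomy.
Variables (F : finFieldType) (g : {unit F}) (C : {group {unit F}}).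

Definition cyclotomic_class (i : nat) : {set F} :=
  [set FinRing.uval u | u in (g ^+ i *: C)%g].

Variables (k : nat) (alpha : 'I_k -> bool).

Definition signed_class (i : 'I_k) : {set F} :=
  [set (-1) ^+ alpha i * x | x in cyclotomic_class i].

(* C is meant to be the subgroup of index 2k of the unit group; the second
   conjunct is the normalisation alpha_0 = 0. *)
Definition cyclotomic_half_set (V : {set F}) : Prop :=
  V = \bigcup_(i < k) signed_class i /\
  (forall i : 'I_k, i = 0%N :> nat -> alpha i = false).

End Cyclotomy.

Section HeffterDifferenceMatrices.
Variables (F : finFieldType) (k r : nat).

Definition heffter_difference_matrix (V_ : 'I_k -> {set F})
    (B : 'M[F]_(r, k)) : Prop :=
  [/\ forall h, \sum_i B h i = 0,
      forall h i, B h i \in V_ i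
    & forall i j : 'I_k, (i < j)%N -> injective (fun h => B h i / B h j)].

Definition simple_matrix (B : 'M[F]_(r, k)) : Prop :=
  forall h, simple_seq [seq B h i | i <- enum 'I_k].

End HeffterDifferenceMatrices.

(* Main.v *)
Require Import Defs.
From HB Require Import structures.
From mathcomp Require Import all_boot all_order all_algebra all_fingroup all_solvable.
From mathcomp Require Import finfield zify.

(** The group [C] = C^{2k} acts on [F] by multiplication, and the [V_i] are [k]
    distinct orbits of size [#|C|].  The blocks are the translates under [C] of
    the rows of the matrix.  A row meets each [V_i] once and [C] acts freely on
    nonzero elements, so the translates of one row partition the union [V] of
    the [V_i]: they form a parallel class.  Two distinct points of a block lie
    in distinct [V_i] and [V_j], so their ratio is that of two entries of the
    row that yields the block; it determines the row, hence the block.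

    The congruence on [q] says that [c := #|C|] is odd.  As [g] has order
    [2 * k * c], [-1 = g ^+ (k * c)] lies in the coset of [g ^+ k] modulo [C].
    In the quotient by [C], cyclic of order [2 * k], the signed classes
    [(-1) ^+ e * C_i] are thus the powers of [g] of exponent [i + k * e], which
    are pairwise distinct.  So [V] is disjoint from [- V], and it has
    [k * c = (q - 1) / 2] elements: it is a half-set. *)

Set Implicit Arguments.
Unset Strict Implicit.
Unset Printing Implicit Defensive.

Import GRing.Theory.
Local Open Scope ring_scope.

Lemma perm_enum_imset (T T' : finType) (f : T -> T') (D : {pred T}) :
  {in D &, injective f} -> perm_eq [seq f x | x <- enum D] (enum (f @: D)).
Proof.
move=> f_inj; apply: uniq_perm; rewrite ?enum_uniq //.
  rewrite map_inj_in_uniq ?enum_uniq // => x y.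
  by rewrite !mem_enum; apply: f_inj.
move=> y; rewrite mem_enum.
by apply/mapP/imsetP=> -[x xD ->]; exists x; rewrite ?mem_enum // in xD *.
Qed.

Lemma scanl_map (S T S' T' : Type) (op : S -> T -> S) (op' : S' -> T' -> S')
    (f : S -> S') (f' : T -> T') (x : S) (s : seq T) :
    (forall y z, f (op y z) = op' (f y) (f' z)) ->
  scanl op' (f x) [seq f' z | z <- s] = [seq f y | y <- scanl op x s].
Proof. by move=> f_op; elim: s x => //= z s IHs x; rewrite -f_op IHs. Qed.

Lemma simple_seq_map (G G' : finZmodType) (f : {additive G -> G'}) (s : seq G) :
  injective f -> simple_seq s -> simple_seq [seq f x | x <- s].
Proof.
move=> f_inj; rewrite /simple_seq -(raddf0 f) (scanl_map _ _ (raddfD f)).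
by rewrite map_inj_uniq.
Qed.

Lemma zero_sum_imset (G G' : finZmodType) (f : {additive G -> G'})
    (A : {set G}) :
  injective f -> zero_sum A -> zero_sum (f @: A).
Proof.
move=> f_inj A_sum0; rewrite /zero_sum big_imset /= => [|x y _ _ /f_inj //].
by rewrite -raddf_sum A_sum0 raddf0.
Qed.

Lemma sum0_card_gt1 (G : finZmodType) (I : finType) (x : I -> G) (i : I) :
  x i != 0 -> \sum_j x j = 0 -> (1 < #|I|)%N.
Proof.
move=> xi_neq0 x_sum0; rewrite ltnNge.
apply: contra xi_neq0 => /card_le1_eqP all_eq.
by rewrite -x_sum0 (big_pred1 i) // => j; rewrite /= (all_eq j i) ?eqxx.
Qed.

Section HalfSets.

Variables (G : finZmodType) (P : {set G}).

Lemma half_set_neq0 x : half_set P -> x \in P -> x != 0.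
Proof. by case=> _ defP xP; rewrite -in_setC1 -defP inE xP. Qed.

Lemma card_setU_opp :
    [disjoint P & [set - x | x in P]] ->
  #|P :|: [set - x | x in P]| = #|P|.*2.
Proof.
rewrite -(leq_card_setU _ _) => /eqP->.
by rewrite card_imset ?addnn //; apply: oppr_inj.
Qed.

Lemma half_set_card : half_set P -> #|P| = ((#|G| - 1) %/ 2)%N.
Proof.
case=> /card_setU_opp + defP; rewrite defP cardsC1 -subn1 divn2 => ->.
by rewrite doubleK.
Qed.

Lemma opp_disjoint_half_set :
    [disjoint P & [set - x | x in P]] -> 0 \notin P -> #|G| = #|P|.*2.+1 ->
  half_set P.
Proof.
move=> disjP P'0 cardG; split=> //; apply/eqP.
rewrite eqEcard card_setU_opp // cardsC1 cardG leqnn andbT.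
apply/subsetP=> x; rewrite !inE; apply: contraL => /eqP->.
by rewrite negb_or P'0 -oppr0 (mem_imset _ _ oppr_inj).
Qed.

End HalfSets.

Lemma resolvable_replication (T : finType) r (P : {set T}) Bl x :
  resolvable r P Bl -> x \in P -> #|[set A in Bl | x \in A]| = r.
Proof.
case=> R [partR <- classR] xP.
have coverR C : C \in R -> x \in cover C.
  by move=> /classR/cover_partition->.
have tiR C : C \in R -> trivIset C by move/classR/partition_trivIset.
have in_pblock C : C \in R -> pblock C x \in C.
  by move=> CR; rewrite pblock_mem ?coverR.
have -> : [set A in Bl | x \in A] = [set pblock C x | C in R].
  apply/setP=> A; rewrite inE -(cover_partition partR).
  apply/andP/imsetP=> [[/bigcupP[C CR AC] xA]|[C CR ->]].
    by exists C => //; rewrite (def_pblock (tiR C CR) AC).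
  rewrite mem_pblock coverR //; split=> //.
  by apply/bigcupP; exists C; rewrite ?in_pblock.
have tiRR := partition_trivIset partR.
rewrite card_in_imset // => C D CR DR eq_pblock.
rewrite -(def_pblock tiRR CR (in_pblock C CR)) eq_pblock.
by rewrite (def_pblock tiRR DR (in_pblock D DR)).
Qed.

Section Development.

Variables (aT : finGroupType) (T : finType) (to : {action aT &-> T}).
Variables (A : {group aT}) (H I : finType) (V : I -> {set T}) (b : H -> I -> T).
Hypothesis V_trans : forall i, [transitive A, on V i | to].
Hypothesis V_free : forall i, {in V i, forall x, {in A &, injective (to x)}}.
Hypothesis V_disj : forall i j, i != j -> [disjoint V i & V j].
Hypothesis b_V : forall h i, b h i \in V i.
Hypothesis pair_orbit_inj : forall i j a h h', i != j -> a \in A ->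
  to (b h i) a = b h' i -> to (b h j) a = b h' j -> h = h'.
Hypothesis columns_gt1 : H -> (1 < #|I|)%N.

Definition base_block h : {set T} := [set b h i | i : I].
Definition translate h a : {set T} := (to^* (base_block h) a)%act.
Definition development h : {set {set T}} := [set translate h a | a in A].
Definition blocks : {set {set T}} := \bigcup_h development h.

Lemma blocksP S :
  reflect (exists h, exists2 a, a \in A & S = translate h a) (S \in blocks).
Proof.
apply: (iffP bigcupP) => [[h _ /imsetP[a aA ->]]|[h [a aA ->]]].
  by exists h, a.
by exists h => //; apply: imset_f.
Qed.

Lemma part_unique x i j : x \in V i -> x \in V j -> i = j.
Proof. by move=> xi; apply: contraTeq => /V_disj/disjointFr->. Qed.

Lemma base_entry_inj h : injective (b h).
Proof. by move=> i j eq_b; apply: (@part_unique (b h i)); rewrite // eq_b. Qed.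

Lemma translate_entry_part h i a : a \in A -> to (b h i) a \in V i.
Proof. by move=> aA; rewrite (acts_act (atrans_acts (V_trans i))). Qed.

Lemma mem_translate_entry h i a : to (b h i) a \in translate h a.
Proof. by rewrite mem_setact ?imset_f. Qed.

Lemma translate_part h i a x :
  a \in A -> x \in translate h a -> x \in V i -> x = to (b h i) a.
Proof.
move=> aA /imsetP[_ /imsetP[j _ ->] ->] /part_unique-/(_ j) -> //.
exact: translate_entry_part.
Qed.

Lemma translate_sub h a : a \in A -> translate h a \subset \bigcup_i V i.
Proof.
move=> aA; apply/subsetP=> _ /imsetP[_ /imsetP[i _ ->] ->]; apply/bigcupP.
by exists i => //; apply: translate_entry_part.
Qed.

Lemma card_translate h a : #|translate h a| = #|I|.
Proof. by rewrite card_setact card_imset //; apply: base_entry_inj. Qed.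

Lemma translates_disjoint h a a' :
    a \in A -> a' \in A -> a != a' ->
  [disjoint translate h a & translate h a'].
Proof.
move=> aA a'A; apply: contraR => /pred0Pn[x /andP[/= xa xa']]; apply/eqP.
have /bigcupP[i _ xi] := subsetP (translate_sub h aA) x xa.
apply: (V_free (b_V h i)) => //.
by rewrite -(translate_part aA xa xi) -(translate_part a'A xa' xi).
Qed.

Lemma translates_two_points h h' a a' x y :
    a \in A -> a' \in A -> x != y ->
    x \in translate h a -> y \in translate h a ->
    x \in translate h' a' -> y \in translate h' a' ->
  h = h'.
Proof.
move=> aA a'A neq_xy xa ya xa' ya'.
have /bigcupP[i _ xi] := subsetP (translate_sub h aA) x xa.
have /bigcupP[j _ yj] := subsetP (translate_sub h aA) y ya.
have [def_x def_y] := (translate_part aA xa xi, translate_part aA ya yj).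
have neq_ij : i != j.
  by apply: contraNneq neq_xy => eq_ij; rewrite def_x def_y eq_ij.
apply: (pair_orbit_inj (a := (a * a'^-1)%g) neq_ij).
- by rewrite groupM ?groupV.
- by rewrite actM -def_x (translate_part a'A xa' xi) actK.
- by rewrite actM -def_y (translate_part a'A ya' yj) actK.
Qed.

Lemma development_partition h : partition (development h) (\bigcup_i V i).
Proof.
have [|a _|part_dev _] := @indexed_partition _ _ (mem A) (translate h).
- move=> a a' aA a'A neq_aa'.
  by apply: translates_disjoint; rewrite // eq_sym.
- by rewrite -card_gt0 card_translate (ltn_trans _ (columns_gt1 h)).
congr partition: part_dev; rewrite cover_imset; apply/eqP.
rewrite eqEsubset; apply/andP; split.
  by apply/bigcupsP=> a aA; apply: translate_sub.
apply/bigcupsP=> i _; apply/subsetP=> x xi; apply/bigcupP.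
have [a aA ->] := atransP2 (V_trans i) (b_V h i) xi.
by exists a; rewrite ?mem_translate_entry.
Qed.

Lemma developments_disjoint h h' :
  h != h' -> [disjoint development h & development h'].
Proof.
apply: contraR => /pred0Pn[_ /andP[/= /imsetP[a aA ->] /imsetP[a' a'A eq_bl]]].
have /card_gt1P[i [j [_ _ neq_ij]]] := columns_gt1 h.
have neq_xy : to (b h i) a != to (b h j) a.
  by rewrite (inj_eq (act_inj to a)) (inj_eq (@base_entry_inj h)).
apply/eqP/(translates_two_points aA a'A neq_xy); rewrite -?eq_bl;
  exact: mem_translate_entry.
Qed.

Lemma blocks_resolvable : resolvable #|H| (\bigcup_i V i) blocks.
Proof.
have [||part_blocks dev_inj] := @indexed_partition H _ predT development.
- by move=> h h' _ _ neq_hh'; apply: developments_disjoint; rewrite eq_sym.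
- by move=> h _; apply/set0Pn; exists (translate h 1); apply: imset_f.
exists (development @: H); split.
- by rewrite cover_imset in part_blocks.
- by rewrite card_in_imset.
- by move=> _ /imsetP[h _ ->]; apply: development_partition.
Qed.

Lemma blocks_configuration :
  configuration #|\bigcup_i V i| #|H| #|blocks| #|I| (\bigcup_i V i) blocks.
Proof.
split=> // [_ /blocksP[h [a aA ->]]|x y _ _ neq_xy|x].
- by rewrite translate_sub ?card_translate.
- apply/card_le1_eqP=> S S' /setIdP[/blocksP[h [a aA ->]] /andP[xS yS]].
  case/setIdP=> /blocksP[h' [a' a'A ->]] /andP[xS' yS'].
  have eq_h := translates_two_points aA a'A neq_xy xS yS xS' yS'.
  rewrite -eq_h in xS' *.
  have [->//|neq_a] := eqVneq a a'.
  by rewrite (disjointFr (translates_disjoint h aA a'A neq_a) xS) in xS'.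
- exact/resolvable_replication/blocks_resolvable.
Qed.

End Development.

Section HeffterSpaceOfMatrix.

Variables (F : finFieldType) (C : {group {unit F}}) (k r : nat).
Variables (V : 'I_k -> {set F}) (B : 'M[F]_(r, k)).
Hypothesis V_trans : forall i, [transitive C, on V i | 'U].
Hypothesis V_disj : forall i j, i != j -> [disjoint V i & V j].
Hypothesis B_heffter : heffter_difference_matrix V B.

Local Notation blocks := (blocks 'U C (fun_of_matrix B)).

Lemma mulr_unit_inj (u : {unit F}) : injective (val u \o* idfun).
Proof. by apply: mulIf; rewrite -unitfE; apply: valP. Qed.

Lemma matrix_row_inj h : injective (B h).
Proof. by have [_ B_V _] := B_heffter; apply: base_entry_inj V_disj B_V h. Qed.

Lemma matrix_pair_orbit_inj i j (u : {unit F}) h h' :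
    i != j -> 'U%act (B h i) u = B h' i -> 'U%act (B h j) u = B h' j ->
  h = h'.
Proof.
have [_ _ ratio_inj] := B_heffter.
wlog lt_ij: i j / (i < j)%N => [wlog_lt neq_ij eq_i eq_j|_ eq_i eq_j].
  have := neq_ij; rewrite neq_ltn => /orP[lt_ij|lt_ji].
    exact: (wlog_lt i j).
  by apply: (wlog_lt j i); rewrite // eq_sym.
apply: (ratio_inj i j lt_ij) => /=.
by rewrite -eq_i -eq_j -mulf_div divff ?mulr1 // -unitfE; apply: valP.
Qed.

Lemma simple_space_of_matrix : simple_matrix B -> simple_space blocks.
Proof.
move=> B_simple _ /blocksP[h [u _ ->]].
exists [seq (val u \o* idfun) x | x <- [seq B h i | i <- enum 'I_k]]; split.
  apply: perm_trans (perm_enum_imset (in2W (@mulr_unit_inj u))).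
  by rewrite perm_map // perm_enum_imset // => i j _ _; apply: matrix_row_inj.
exact: simple_seq_map (@mulr_unit_inj u) (B_simple h).
Qed.

Hypothesis k_gt0 : (0 < k)%N.
Hypothesis V_half : half_set (\bigcup_i V i).

Lemma part_neq0 i x : x \in V i -> x != 0.
Proof. by move=> xi; apply/(half_set_neq0 V_half)/bigcupP; exists i. Qed.

Lemma part_free i : {in V i, forall x, {in C &, injective ('U%act x)}}.
Proof. by move=> x /part_neq0/mulfI mulI u v _ _ /mulI/val_inj. Qed.

Lemma heffter_space_of_matrix :
  heffter_space ((#|F| - 1) %/ 2) k r (\bigcup_i V i) blocks.
Proof.
have [B_sum0 B_V _] := B_heffter.
have columns_gt1 (h : 'I_r) : (1 < k)%N.
  rewrite -[k]card_ord.
  exact: (@sum0_card_gt1 _ _ (B h) (Ordinal k_gt0)) (part_neq0 (B_V _ _)) _.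
have pair_orbit_inj i j (u : {unit F}) h h' neq_ij (_ : u \in C) :=
  @matrix_pair_orbit_inj i j u h h' neq_ij.
split=> //.
- exists #|blocks|; rewrite -(half_set_card V_half).
  have := blocks_configuration V_trans part_free V_disj B_V pair_orbit_inj.
  by rewrite !card_ord; apply.
- have := blocks_resolvable V_trans part_free V_disj B_V.
  by rewrite !card_ord; apply.
- move=> _ /blocksP[h [u _ ->]].
  apply: (@zero_sum_imset _ _ (val u \o* idfun)); first exact: mulr_unit_inj.
  by rewrite /zero_sum big_imset // => i j _ _; apply: matrix_row_inj.
Qed.

End HeffterSpaceOfMatrix.

Lemma order_coset_generator (gT : finGroupType) (G K : {group gT}) x :
  (K <| G)%g -> generator G x -> #[coset K x]%g = #|G : K|%g.
Proof.
move=> /andP[_ nKG] genGx; have Gx : x \in G by rewrite (eqP genGx) cycle_id.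
have nKx := subsetP nKG x Gx.
by rewrite orderE -(eqP (quotient_generator nKx genGx)) card_quotient.
Qed.

Lemma unit_subgroup_normal (F : finFieldType) (C : {group {unit F}}) :
  (C <| [set: {unit F}])%g.
Proof.
rewrite -sub_abelian_normal ?subsetT //; apply/centsP=> u _ v _.
exact/val_inj/mulrC.
Qed.

Lemma val_expg_half_order (F : finFieldType) (u : {unit F}) n :
  (0 < n)%N -> #[u]%g = n.*2 -> val (u ^+ n)%g = -1.
Proof.
move=> n_gt0 ord_u; have /eqP : val (u ^+ n)%g ^+ 2 = 1.
  by rewrite -FinRing.val_unitX -expgM muln2 -ord_u expg_order.
rewrite sqrf_eq1 => /orP[|/eqP//]; rewrite -[1]/(val (1%g : {unit F})).
by rewrite (inj_eq val_inj) -order_dvdn ord_u => /(dvdn_leq n_gt0); lia.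
Qed.

Section CyclotomicClasses.

Variables (F : finFieldType) (k : nat) (C : {group {unit F}}).
Hypothesis C_index : #|[set: {unit F}] : C|%g = (2 * k)%N.

Lemma half_index_gt0 : (0 < k)%N.
Proof. by have := indexg_gt0 [set: {unit F}] C; rewrite C_index; lia. Qed.

Lemma card_field_index : #|F| = (2 * k * #|C|).+1.
Proof.
rewrite -C_index mulnC Lagrange ?subsetT // card_finField_unit prednK //.
exact: ltnW (finNzRing_gt1 F).
Qed.

Lemma odd_card_of_modulus : #|F| = 2 * k + 1 %[mod 4 * k] -> odd #|C|.
Proof.
rewrite card_field_index -[(2 * k * _).+1]addn1 => /eqP.
rewrite eqn_modDr -[X in _ == X %[mod _]]muln1 -[4%N]/(2 * 2)%N.
rewrite [(2 * 2 * k)%N]mulnAC -!muln_modr.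
rewrite eqn_pmul2l ?muln_gt0 ?half_index_gt0 // modn2.
by case: (odd #|C|).
Qed.

Variable g : {unit F}.
Hypothesis g_prim : generator [set: {unit F}]%G g.

(* [g ^+ (k * #|C|)] is the unit [-1]. *)
Definition signed_unit (e : bool) (i : nat) : {unit F} :=
  (g ^+ (k * #|C|) ^+ e * g ^+ i)%g.

Definition signed_coset e i : {set F} :=
  [set FinRing.uval u | u in (signed_unit e i *: C)%g].

Lemma val_signed_unit e i : val (signed_unit e i) = (-1) ^+ e * val (g ^+ i)%g.
Proof.
rewrite FinRing.val_unitM FinRing.val_unitX val_expg_half_order //.
  by rewrite muln_gt0 half_index_gt0 cardG_gt0.
by rewrite orderE -(eqP g_prim) card_finField_unit card_field_index; lia.
Qed.

Lemma signed_cosetP e i x :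
  reflect (exists2 u, u \in C & x = val (signed_unit e i * u)%g)
          (x \in signed_coset e i).
Proof.
apply: (iffP imsetP) => [[_ /lcosetP[u uC ->] ->]|[u uC ->]]; first by exists u.
by exists (signed_unit e i * u)%g; rewrite // mem_lcoset mulKg.
Qed.

Lemma signed_coset_neq0 e i x : x \in signed_coset e i -> x != 0.
Proof. by case/imsetP=> u _ ->; rewrite -unitfE; apply: valP. Qed.

Lemma card_signed_coset e i : #|signed_coset e i| = #|C|.
Proof. by rewrite card_imset ?card_lcoset //; apply: val_inj. Qed.

Lemma opp_signed_coset e i x :
  x \in signed_coset e i -> - x \in signed_coset (~~ e) i.
Proof.
case/signed_cosetP=> u uC ->; apply/signed_cosetP; exists u => //.
rewrite !(FinRing.val_unitM _ u) !val_signed_unit -!mulNr.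
by case: e; rewrite ?opprK.
Qed.

Lemma signed_classE (alpha : 'I_k -> bool) i :
  signed_class g C alpha i = signed_coset (alpha i) i.
Proof.
rewrite /signed_class /cyclotomic_class /signed_coset lcosetM.
rewrite -[(_ *: (_ *: _))%g]lcosetE -!imset_comp.
apply: eq_imset => u /=; rewrite -[(-1) ^+ _]mulr1.
by rewrite -(val_signed_unit (alpha i) 0) /signed_unit mulg1.
Qed.

Lemma signed_class_transitive (alpha : 'I_k -> bool) i :
  [transitive C, on signed_class g C alpha i | 'U].
Proof.
suff -> : signed_class g C alpha i = orbit 'U C (val (signed_unit (alpha i) i)).
  exact: atrans_orbit.
rewrite signed_classE; apply/setP=> x.
by apply/signed_cosetP/orbitP=> -[u uC eq_x]; exists u.
Qed.

Hypothesis C_odd : odd #|C|.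

Lemma coset_signed_unit e i :
  coset C (signed_unit e i) = (coset C g ^+ (i + k * e))%g.
Proof.
have nC (u : {unit F}) : u \in 'N(C)%g.
  by rewrite (subsetP (normal_norm (unit_subgroup_normal C))) ?inE.
rewrite /signed_unit -!expgM -expgD morphX //; apply/eqP.
rewrite eq_expg_mod_order (order_coset_generator (unit_subgroup_normal C)) //.
rewrite C_index addnC eqn_modDl -[X in (k * X * e)%N]odd_double_half C_odd.
rewrite (_ : k * _ * e = #|C|./2 * e * (2 * k) + k * e)%N; last by lia.
by rewrite modnMDl.
Qed.

Lemma signed_coset_inj x e e' (i i' : 'I_k) :
  x \in signed_coset e i -> x \in signed_coset e' i' -> e = e' /\ i = i'.
Proof.
case/signed_cosetP=> u uC -> /signed_cosetP[u' u'C] /val_inj.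
move/(congr1 (coset C)); rewrite (coset_kerr _ uC) (coset_kerr _ u'C).
rewrite !coset_signed_unit => /eqP; rewrite eq_expg_mod_order.
rewrite (order_coset_generator (unit_subgroup_normal C)) // C_index.
have [lt_i lt_i'] := (ltn_ord i, ltn_ord i').
rewrite !modn_small; [| by case: (e'); lia | by case: (e); lia].
by case: e; case: e' => /eqP eq_ii'; split=> //; try apply: ord_inj; lia.
Qed.

Variable alpha : 'I_k -> bool.

Lemma signed_class_disjoint i j :
  i != j -> [disjoint signed_class g C alpha i & signed_class g C alpha j].
Proof.
apply: contraR => /pred0Pn[x /andP[/=]]; rewrite !signed_classE => xi xj.
by have [_ ->] := signed_coset_inj xi xj.
Qed.

Lemma card_signed_classes :
  #|\bigcup_i signed_class g C alpha i| = (k * #|C|)%N.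
Proof.
rewrite -sum1_card (partition_disjoint_bigcup _ _ signed_class_disjoint).
under eq_bigr do rewrite sum1_card signed_classE card_signed_coset.
by rewrite sum_nat_const card_ord.
Qed.

Lemma signed_classes_half_set : half_set (\bigcup_i signed_class g C alpha i).
Proof.
apply: opp_disjoint_half_set.
- apply/pred0P=> x /=; apply/negP=> /andP[/bigcupP[i _]].
  rewrite signed_classE => xi /imsetP[y /bigcupP[j _]]; rewrite signed_classE.
  move=> /opp_signed_coset yj def_x; rewrite def_x in xi.
  have [eq_alpha eq_ij] := signed_coset_inj xi yj.
  by move: eq_alpha; rewrite eq_ij; case: (alpha j).
- apply/bigcupP=> -[i _]; rewrite signed_classE => /signed_coset_neq0.
  by rewrite eqxx.
- by rewrite card_signed_classes card_field_index -mul2n mulnA.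
Qed.

End CyclotomicClasses.

Theorem theorem2p2 (F : finFieldType) (k r : nat)
    (k_ge1 : (1 <= k)%N)
    (q_mod : #|F| = 2 * k + 1 %[mod 4 * k])
    (g : {unit F}) (g_prim : generator [set: {unit F}]%G g)
    (C : {group {unit F}}) (C_index : #|[set: {unit F}] : C|%g = (2 * k)%N)
    (alpha : 'I_k -> bool) (V : {set F})
    (hV : cyclotomic_half_set g C alpha V)
    (B : 'M[F]_(r, k))
    (hB : heffter_difference_matrix (signed_class g C alpha) B) :
  exists (P : {set F}) (Bl : {set {set F}}),
    heffter_space ((#|F| - 1) %/ 2) k r P Bl /\
    (simple_matrix B -> simple_space Bl).
Proof.
have C_odd := odd_card_of_modulus C_index q_mod.
have V_trans := signed_class_transitive C_index g_prim alpha.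
have V_disj := @signed_class_disjoint _ _ _ C_index _ g_prim C_odd alpha.
have V_half := signed_classes_half_set C_index g_prim C_odd alpha.
exists V, (blocks 'U C (fun_of_matrix B)); have [-> _] := hV; split.
  exact: (heffter_space_of_matrix V_trans V_disj hB k_ge1 V_half).
exact: (simple_space_of_matrix V_disj hB).
Qed.
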